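(* Let $NBV[a,b]$ be the Banach space of normalized real functions of bounded variation on $[a,b]$, endowed with the norm $\varphi(f)=|f|([a,b])$ (the total variation of $f$ on $[a,b]$). Then $\varphi$ is not $G$-differentiable at any point $f\in NBV[a,b]$.
   Context: Let $X,Y$ be Banach spaces. A function $F:X\to Y$ is $G$-differentiable (Gâteaux differentiable) at $a\in X$ if there is a continuous linear map $u:X\to Y$ such that for all $h\in X$, $\lim_{t\to0^+}\frac{F(a+th)-F(a)}{t}=u(h)$ in norm. Here $a<b$ are real numbers; ''normalized'' means $f(a)=0$ and $f$ is left-continuous on $(a,b]$. *)

(* Defs.v *)
From HB Require Import structures.
From mathcomp Require Import all_boot all_order all_algebra.
From mathcomp Require Import all_classical all_reals all_analysis.
From mathcomp Require Import ring lra.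

Set Implicit Arguments.
Unset Strict Implicit.
Unset Printing Implicit Defensive.

Import Order.TTheory GRing.Theory Num.Theory.
Import numFieldNormedType.Exports.

Local Open Scope classical_set_scope.
Local Open Scope ring_scope.

Definition Gdifferentiable (K : realType) (X Y : completeNormedModType K)
    (F : X -> Y) (a : X) : Prop :=
  exists2 u : {linear X -> Y}, continuous u &
    forall h : X, t^-1 *: (F (a + t *: h) - F a) @[t --> 0^'+] --> u h.

Section nbv_pred.
Context {R : realType} (a b : R).

(* A function on [a, b] is encoded as a function on R vanishing outside [a, b];
   the last condition only makes this encoding unique. *)
Definition is_nbv (f : R -> R) : Prop :=
  [/\ bounded_variation a b f,
      f a = 0,
      (forall x, x \in `]a, b] -> f t @[t --> x^'-] --> f x) &
      (forall x, x \notin `[a, b] -> f x = 0)].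

Definition nbv_pred : {pred R -> R} := [pred f | `[< is_nbv f >]].

Lemma nbv_predP f : reflect (is_nbv f) (f \in nbv_pred).
Proof. exact: asboolP. Qed.

Lemma variationZ k f s :
  variation a b (k *: f) s = `|k| * variation a b f s.
Proof.
rewrite /variation mulr_sumr; apply: eq_bigr => i _ /=.
by rewrite -normrM mulrBr.
Qed.

Lemma nbv_submod_closed : a < b -> submod_closed nbv_pred.
Proof.
move=> ab; split.
  apply/nbv_predP; split => //; last by move=> x _; exact: cvg_cst.
  exists 0 => _ [s _ <-].
  by rewrite /variation big1// => i _ /=; rewrite subrr normr0.
move=> k f g /nbv_predP[bf fa lf f0] /nbv_predP[bg ga lg g0].
apply/nbv_predP; split.
- apply: bounded_variationD => //; case: bf => M fM.
  exists (`|k| * M) => _ [s abs <-]; rewrite variationZ ler_wpM2l//.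
  by apply: fM; exact: variations_variation.
- by rewrite !fctE fa ga scaler0 addr0.
- move=> x xab; apply: cvgD; last exact: lg.
  by apply: cvgZl_tmp; exact: lf.
- by move=> x xab; rewrite !fctE f0// g0// scaler0 addr0.
Qed.

End nbv_pred.

Record NBV (R : realType) (a b : R) (ab : a < b) := MkNBV {
  nbv_fun :> R -> R;
  _ : nbv_fun \in nbv_pred a b }.

Section NBV_lmodule.
Context {R : realType} (a b : R) (ab : a < b).

HB.instance Definition _ := [isSub for @nbv_fun R a b ab].
HB.instance Definition _ := [Choice of NBV ab by <:].
HB.instance Definition _ := GRing.isSubmodClosed.Build _ _ (nbv_pred a b)
  (nbv_submod_closed ab).
HB.instance Definition _ := [SubChoice_isSubLmodule of NBV ab by <:].

End NBV_lmodule.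

Section NBV_norm.
Context {R : realType} (a b : R) (ab : a < b).
Implicit Types f g : NBV ab.

Definition nbv_norm f : R := fine (total_variation a b f).

Lemma nbvP f : is_nbv a b f.
Proof. by apply/nbv_predP; exact: valP. Qed.

Lemma nbv_normE f : nbv_norm f = sup (variations a b f).
Proof.
rewrite /nbv_norm /total_variation ereal_sup_EFin//; first by case: (nbvP f).
exact: variations_neq0.
Qed.

Lemma variation_le_norm f s :
  itv_partition a b s -> variation a b f s <= nbv_norm f.
Proof.
move=> abs; rewrite nbv_normE; apply: ub_le_sup; first by case: (nbvP f).
exact: variations_variation.
Qed.

Lemma nbv_norm_le f M :
  (forall s, itv_partition a b s -> variation a b f s <= M) -> nbv_norm f <= M.
Proof.
move=> fM; rewrite nbv_normE; apply: ge_sup; first exact: variations_neq0.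
by move=> _ [s abs <-]; exact: fM.
Qed.

Lemma nbv_norm_ge0 f : 0 <= nbv_norm f.
Proof. by apply: fine_ge0; apply: total_variation_ge0; exact: ltW. Qed.

Lemma ler_nbv_normD f g : nbv_norm (f + g) <= nbv_norm f + nbv_norm g.
Proof.
apply: nbv_norm_le => s abs; rewrite (le_trans (variation_le _ _ _ _ _))//.
by rewrite lerD// variation_le_norm.
Qed.

Lemma nbv_normZ_le k f : nbv_norm (k *: f) <= `|k| * nbv_norm f.
Proof.
apply: nbv_norm_le => s abs.
by rewrite [leLHS]variationZ ler_wpM2l// variation_le_norm.
Qed.

Lemma nbv_normZ k f : nbv_norm (k *: f) = `|k| * nbv_norm f.
Proof.
apply/eqP; rewrite eq_le nbv_normZ_le/=.
have [->|k0] := eqVneq k 0; first by rewrite normr0 mul0r nbv_norm_ge0.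
rewrite -ler_pdivlMl ?normr_gt0// -normfV -{1}[f](scalerK k0).
exact: nbv_normZ_le.
Qed.

Lemma nbv_le_norm f x : `|f x| <= nbv_norm f.
Proof.
have [_ fa _ f0] := nbvP f.
have [xab|/f0 ->] := boolP (x \in `[a, b]); last by rewrite normr0 nbv_norm_ge0.
move: xab; rewrite in_itv/= => /andP[].
rewrite le_eqVlt => /predU1P[<- _|ax]; first by rewrite fa normr0 nbv_norm_ge0.
have -> : `|f x| = `|f x - f a| by rewrite fa subr0.
rewrite le_eqVlt => /predU1P[->|xb].
  apply: le_trans (variation_le_norm f (itv_partition1 ab)).
  by rewrite /variation/= big_nat1.
have abs : itv_partition a b [:: x; b] by rewrite /itv_partition/= ax xb.
apply: le_trans (variation_le_norm f abs).
by rewrite /variation/= big_nat_recl// big_nat1/= lerDl.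
Qed.

Lemma nbv_norm0_eq0 f : nbv_norm f = 0 -> f = 0.
Proof.
move=> f0; apply: val_inj; apply/funext => x; apply/eqP.
by rewrite -normr_le0 -f0 nbv_le_norm.
Qed.

HB.instance Definition _ := @Lmodule_isNormed.Build R (NBV ab)
  nbv_norm ler_nbv_normD nbv_normZ nbv_norm0_eq0.

Lemma NBV_normE f : `|f| = fine (total_variation a b f).
Proof. by []. Qed.

Lemma NBV_complete (F : set_system (NBV ab)) :
  ProperFilter F -> cauchy F -> cvg F.
Proof.
move=> FF /cauchy_ballP Fc.
have Fc' (e : R) : 0 < e -> \forall g & h \near F, `|g - h| <= e.
  move=> e0; have := Fc e e0; apply: filterS => -[g h] /=.
  by rewrite -ball_normE /= => /ltW.
have Fx x : cvg ((g : NBV ab) x @[g --> F]).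
  apply/cauchy_cvgP/cauchy_exP => e e0.
  have := Fc e e0 => /nearP_dep/filter_ex[g gh].
  exists (g x); apply: filterS gh => h; rewrite -!ball_normE /=.
  by apply: le_lt_trans; exact: (nbv_le_norm (g - h)).
pose f x : R := lim ((g : NBV ab) x @[g --> F]).
have vg (e : R) : 0 < e -> \forall g \near F,
    forall s, itv_partition a b s -> variation a b (\val g - f) s <= e.
  move=> e0; have := Fc' e e0; move=> /nearP_dep; apply: filterS => g gh s abs.
  have vgf : variation a b (g - h) s @[h --> F] --> variation a b (\val g - f) s.
    apply: cvg_big => [|i _]; first exact: add_continuous.
    apply: cvg_norm.
    by apply: cvgB; apply: cvgB; by [exact: cvg_cst|exact: Fx].
  rewrite -(cvg_lim _ vgf)//; apply: limr_le; first by apply/cvg_ex; eexists; exact: vgf.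
  by apply: filterS gh => h; apply: le_trans; exact: variation_le_norm.
have ug (e : R) : 0 < e -> \forall g \near F, forall x, `|(g : NBV ab) x - f x| <= e.
  move=> e0; have := Fc' e e0; move=> /nearP_dep; apply: filterS => g gh x.
  have gf : `|g x - (h : NBV ab) x| @[h --> F] --> `|g x - f x|.
    by apply: cvg_norm; apply: cvgB; by [exact: cvg_cst|exact: Fx].
  rewrite -(cvg_lim _ gf)//; apply: limr_le.
    by apply/cvg_ex; eexists; exact: gf.
  by apply: filterS gh => h; apply: le_trans; exact: (nbv_le_norm (g - h)).
have f_nbv : f \in nbv_pred a b.
  near F => g0.
  apply/nbv_predP; split.
  - have bg : bounded_variation a b g0 by case: (nbvP g0).
    have bgf : bounded_variation a b (\val g0 - f).
      exists 1 => _ [s abs <-]; move: s abs; near: g0; exact: vg.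
    have -> : f = (g0 : R -> R) \+ (\- (\val g0 - f)).
      by apply/funext => x; rewrite !fctE/= opprB addrC subrK.
    by apply: bounded_variationD => //; exact: bounded_variationN.
  - rewrite /f; have -> : (fun g : NBV ab => g a) = cst 0.
      by apply/funext => g; case: (nbvP g).
    exact: lim_cst.
  - move=> x xab; apply/cvgrPdist_le => e e0.
    have e3 : 0 < e / 3 by rewrite divr_gt0.
    have /filter_ex[g gf] := ug _ e3.
    have [_ _ /(_ x xab)/cvgrPdist_le/(_ _ e3) lg _] := nbvP g.
    apply: filterS lg => t gt.
    have -> : f x - f t = (g t - f t) + ((g x - g t) - (g x - f x)) by ring.
    rewrite (le_trans (ler_normD _ _))// (le_trans (lerD (lexx _) (ler_normB _ _)))//.
    have := gf x; have := gf t; move: gt; lra.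
  - move=> x xab; rewrite /f; have -> : (fun g : NBV ab => g x) = cst 0.
      by apply/funext => g; have [_ _ _ ->] := nbvP g.
    exact: lim_cst.
pose f' : NBV ab := MkNBV ab f_nbv.
apply/cvg_ex; exists f'; apply/cvgrPdist_le => e e0.
have := vg e e0; apply: filterS => g gf.
by rewrite distrC; apply: nbv_norm_le.
Unshelve. all: by end_near. Qed.

HB.instance Definition _ := Uniform_isComplete.Build (NBV ab) NBV_complete.

End NBV_norm.

(* Main.v *)
Require Import Defs.
From mathcomp Require Import all_boot all_order all_algebra.
From mathcomp Require Import all_classical all_reals all_analysis.
From mathcomp Require Import lra.
Import Order.TTheory GRing.Theory Num.Theory.
Import numFieldNormedType.Exports.
Local Open Scope classical_set_scope.
Local Open Scope ring_scope.

(** The total variation is convex, and it has a corner at [f] in the direction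
    of a unit jump placed where [f] has no jump.  The variation function
    [x |-> |f|([a, x])] is nondecreasing, hence continuous outside a countable
    set, so it is continuous at some [c] in [(a, b)]
    ([exists_small_variation_right]): [f] has arbitrarily small variation on
    suitable intervals [[c, d]].  Let [h] be the indicator function of [(c, b]].
    On such an interval the increment of [f + k h] is nearly [k], whereas on
    [[a, c]] and [[d, b]] the function [f + k h] differs from [f] by a constant;
    by additivity over intervals, [|f + k h|([a, b]) >= |f|([a, b]) + |k|]
    for every real [k] ([total_variation_add_jump]).  The one-sided
    directional derivatives of the norm at [f] in the directions [h] and [- h]
    are therefore both at least [1], while a linear map takes opposite values
    there. *)

Lemma le_total_variation_add_cst (R : realType) (a b k : R) (f g : R -> R) :
  a <= b -> {in `[a, b], forall x, f x = g x + k} ->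
  (total_variation a b f <= total_variation a b g)%E.
Proof.
move=> ab fgk.
have -> : f = g \+ (f \- g) by apply/funext => x /=; rewrite addrC subrK.
apply: le_trans (total_variation_le _ _ ab) _.
have fgE x : x \in `[a, b] -> (f \- g) x = k by move=> /fgk /= ->; rewrite addrC addKr.
rewrite [X in (_ + X)%E]nondecreasing_total_variation//.
  by rewrite !fgE ?bound_itvE// subrr adde0.
by move=> x y xab yab _; rewrite !fgE.
Qed.

Lemma fin_num_total_variation (R : realType) (a b x y : R) (f : R -> R) :
  bounded_variation a b f -> a <= x -> x <= y -> y <= b ->
  total_variation x y f \is a fin_num.
Proof.
move=> bvf ax xy yb; apply/bounded_variationP => //.
apply: (bounded_variationl xy yb).
by apply: bounded_variationr bvf => //; exact: le_trans yb.
Qed.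

(** The nondecreasing function [x |-> |f|([a, x])] has only countably many
    jumps, so it has equal one-sided limits at some [c] in the uncountable
    interval [(a, b)]; its increment across [c] is then arbitrarily small. *)
Lemma exists_small_variation_right (R : realType) (a b : R) (f : R -> R) :
  a < b -> bounded_variation a b f ->
  exists2 c, c \in `]a, b[ & forall e, 0 < e ->
    exists d, [/\ c < d, d < b & (total_variation c d f < e%:E)%E].
Proof.
move=> ab bvf; pose F := fine \o (total_variation a ^~ f).
have Ffin x : x \in `[a, b] -> total_variation a x f \is a fin_num.
  by rewrite in_itv/= => /andP[ax xb]; exact: fin_num_total_variation bvf _ ax xb.
have ndF : {in `[a, b] &, nondecreasing_fun F}.
  move=> x y xab yab xy; apply: fine_le; rewrite ?Ffin//.
  exact: (@total_variation_nondecreasing _ a b f x y xab yab xy).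
have [c cab ncF] : exists2 c, c \in `]a, b[ & ~ discontinuity F c.
  apply: contrapT => noc.
  have := countable_lebesgue_measure0 (discontinuity_countable ndF).
  have -> : [set x | x \in (`]a, b[) /\ discontinuity F x] = [set` `]a, b[].
    apply/seteqP; split => x /=; first by case.
    by move=> xab; split => //; apply: contrapT => nd; apply: noc; exists x.
  rewrite lebesgue_measure_itv/= lte_fin ab -EFinB => -[] /eqP.
  by rewrite subr_eq0 gt_eqF.
exists c => // e e0.
move: (cab); rewrite in_itv/= => /andP[ac cb].
have cab' : c \in `[a, b] by exact: subset_itv_oo_cc.
have cvl : cvg (F x @[x --> c^'-]).
  apply: nondecreasing_at_left_is_cvgr; near=> r.
    apply: sub_in2 ndF => x; rewrite !in_itv/= => /andP[rx xc].
    apply/andP; split; last exact: ltW (lt_trans xc cb).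
    by apply: ltW (le_lt_trans _ rx); near: r; exact: nbhs_left_ge.
  exists (F c) => _ [z + <-]; rewrite /= in_itv/= => /andP[rz zc].
  apply: ndF (ltW zc) => //; rewrite in_itv/= (ltW (lt_trans zc cb)) andbT.
  by apply: ltW (le_lt_trans _ rz); near: r; exact: nbhs_left_ge.
have cvr : cvg (F x @[x --> c^'+]).
  apply: nondecreasing_at_right_is_cvgr; near=> r.
    apply: sub_in2 ndF => x; rewrite !in_itv/= => /andP[cx xr].
    apply/andP; split; first exact: ltW (lt_trans ac cx).
    by apply: ltW (lt_le_trans xr _); near: r; exact: nbhs_right_le.
  exists (F c) => _ [z + <-]; rewrite /= in_itv/= => /andP[cz zr].
  apply: ndF (ltW cz) => //; rewrite in_itv/= (ltW (lt_trans ac cz))/=.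
  by apply: ltW (lt_le_trans zr _); near: r; exact: nbhs_right_le.
have lrE : lim (F x @[x --> c^'-]) = lim (F x @[x --> c^'+]).
  by apply/eqP/negPn/negP => lr; apply: ncF; split.
have e2 : 0 < e / 2 by rewrite divr_gt0.
have /cvgrPdist_lt/(_ _ e2) Fl := cvl; have /cvgrPdist_lt/(_ _ e2) Fr := cvr.
have [l [Fle al lc]] : exists l, [/\
    `|lim (F x @[x --> c^'-]) - F l| < e / 2, a < l & l < c].
  near (c^'-) => l; exists l; split; first by near: l; exact: Fl.
  - by near: l; exact: nbhs_left_gt.
  - by near: l; exact: nbhs_left_lt.
have [d [Fde cd db]] : exists d, [/\
    `|lim (F x @[x --> c^'+]) - F d| < e / 2, c < d & d < b].
  near (c^'+) => d; exists d; split; first by near: d; exact: Fr.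
  - by near: d; exact: nbhs_right_gt.
  - by near: d; exact: nbhs_right_lt.
exists d; split => //.
(* [F c] is squeezed between [F l] and [F d], both close to the common limit. *)
have Flc : F l <= F c.
  by apply: ndF (ltW lc); rewrite // in_itv/= (ltW al)/= (ltW (lt_trans lc cb)).
have cdfin : total_variation c d f \is a fin_num.
  exact: fin_num_total_variation bvf (ltW ac) (ltW cd) (ltW db).
have FdE : F d = F c + fine (total_variation c d f).
  by rewrite /F/= (total_variationD f (ltW ac) (ltW cd)) fineD// Ffin.
rewrite -(fineK cdfin) lte_fin.
move: Fle Fde; rewrite lrE !ltr_norml => /andP[? ?] /andP[? ?]; lra.
Unshelve. all: by end_near. Qed.

(** Cutting [[a, b]] at [c] and [d] leaves the variation of [f] unchanged on the
    outer pieces; on [[c, d]], where [f] varies by less than [e], the increment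
    of the perturbed function is at least [|k| - e] in absolute value. *)
Lemma total_variation_add_jump (R : realType) (a b c k : R) (f g : R -> R) :
  a <= c -> bounded_variation a b f -> bounded_variation a b g ->
  (forall e, 0 < e ->
    exists d, [/\ c < d, d < b & (total_variation c d f < e%:E)%E]) ->
  {in `[a, c], f =1 g} -> {in `]c, b], forall x, g x = f x + k} ->
  fine (total_variation a b f) + `|k| <= fine (total_variation a b g).
Proof.
move=> ac bvf bvg small fgl fgr; apply/ler_addgt0Pr => e e0.
have [d [cd db fe]] := small _ (divr_gt0 e0 (ltr0n _ 2)).
have [cd' db' ad] : [/\ c <= d, d <= b & a <= d].
  by split; [exact: ltW|exact: ltW|exact: le_trans (ltW cd)].
have cut h : bounded_variation a b h -> fine (total_variation a b h) =
    fine (total_variation a c h) + fine (total_variation c d h) +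
    fine (total_variation d b h).
  move=> bvh; rewrite (total_variationD h ad db') (total_variationD h ac cd').
  have fin x y := @fin_num_total_variation _ a b x y h bvh.
  by rewrite !fineD ?fin_numD ?fin ?lexx// (le_trans cd').
have fin h x y := @fin_num_total_variation _ a b x y h.
have cb : c <= b by exact: le_trans db'.
have left_le : fine (total_variation a c f) <= fine (total_variation a c g).
  apply: fine_le; rewrite ?fin//.
  by apply: (@le_total_variation_add_cst _ _ _ 0) => // x /fgl ->; rewrite addr0.
have right_le : fine (total_variation d b f) <= fine (total_variation d b g).
  apply: fine_le; rewrite ?fin//.
  apply: (@le_total_variation_add_cst _ _ _ (- k)) => // x.
  rewrite in_itv/= => /andP[dx xb].
  by rewrite fgr ?addrK// in_itv/= xb andbT (lt_le_trans cd).
have gcd : `|g d - g c| <= fine (total_variation c d g).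
  by rewrite -lee_fin fineK ?fin//; exact: total_variation_ge.
have fcd : `|f d - f c| <= fine (total_variation c d f).
  by rewrite -lee_fin fineK ?fin//; exact: total_variation_ge.
have {}fe : fine (total_variation c d f) < e / 2.
  by rewrite -lte_fin fineK ?fin.
have kle : `|k| <= `|g d - g c| + `|f d - f c|.
  have -> : k = (g d - g c) - (f d - f c).
    have gd : g d = f d + k by apply: fgr; rewrite in_itv/= cd db'.
    have gc : f c = g c by apply: fgl; rewrite in_itv/= ac lexx.
    rewrite gd gc; lra.
  exact: ler_normB.
rewrite !cut//; lra.
Qed.

(** The interval is open at [c] so that the jump is left-continuous, and so that
    the function vanishes at [a] even when [c = a]. *)
Lemma is_nbv_jump (R : realType) (a b c : R) : a <= c ->
  is_nbv a b \1_([set` `]c, b]] : set R).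
Proof.
move=> ac.
have E x : \1_([set` `]c, b]] : set R) x = (c < x <= b)%R%:R :> R.
  by rewrite indicE mem_setE in_itv.
split.
- apply: nondecreasing_bounded_variation => x y.
  rewrite !in_itv/= => /andP[_ xb] /andP[_ yb] xy.
  rewrite !E xb yb !andbT ler_nat.
  by case: (ltP c x) => // cx; rewrite (lt_le_trans cx xy).
- by rewrite E ltNge ac.
- move=> x; rewrite in_itv/= => /andP[ax xb].
  apply: cvg_near_cst; have [xc|cx] := leP x c; near=> t.
    have tx : t < x by near: t; exact: nbhs_left_lt.
    by rewrite !E !ltNge xc (ltW (lt_le_trans tx xc)).
  have tx : t < x by near: t; exact: nbhs_left_lt.
  have ct : c < t by near: t; exact: nbhs_left_gt.
  by rewrite !E xb (ltW (lt_le_trans tx xb)) cx ct.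
- move=> x; rewrite in_itv/= E => xab; case: (ltP c x) => //= cx.
  by move: xab; rewrite (ltW (le_lt_trans ac cx)) /= => /negbTE ->.
Unshelve. all: by end_near. Qed.

Theorem theorem3p2 (R : realType) (a b : R) (ab : a < b) (f : NBV ab) :
  ~ Gdifferentiable (fun g : NBV ab => fine (total_variation a b g)) f.
Proof.
move=> [u _ du].
have bv (g : NBV ab) : bounded_variation a b g by case: (nbvP g).
have [c + small] := exists_small_variation_right _ _ _ _ ab (bv f).
rewrite in_itv/= => /andP[/ltW ac _].
pose h : NBV ab := MkNBV ab (introT (nbv_predP _ _ _) (is_nbv_jump _ a b c ac)).
have jump k : fine (total_variation a b f) + `|k| <=
              fine (total_variation a b (f + k *: h : NBV ab)).
  have hE x : h x = (c < x <= b)%R%:R by rewrite /= indicE mem_setE in_itv.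
  have fkhE x : (f + k *: h : NBV ab) x = f x + k * h x by [].
  apply: (total_variation_add_jump _ _ _ c k) => // x; rewrite fkhE hE in_itv.
    by move=> /= /andP[_ xc]; rewrite ltNge xc mulr0 addr0.
  by move=> /= ->; rewrite mulr1.
have slope s : `|s| = 1 -> 1 <= u (s *: h).
  move=> s1; apply: (cvgr_to_ge (du (s *: h))); near=> t.
  have t0 : 0 < t by near: t; exact: nbhs_right_gt.
  rewrite /GRing.scale/= ler_pdivlMl// mulr1 lerBrDl.
  have := jump (t * s).
  by rewrite normrM s1 mulr1 gtr0_norm// -scalerA.
have := slope 1 (normr1 _); have := slope (-1) (normrN1 _).
by rewrite scale1r scaleN1r linearN; lra.
Unshelve. all: by end_near. Qed.
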